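(* Let $G$ be a finite group. Then the following conditions are equivalent: (a) $G$ can uniquely be written as the union of three proper subgroups, i.e. there is exactly one set $\{H_1,H_2,H_3\}$ of three proper subgroups of $G$ with $G=H_1\cup H_2\cup H_3$. (b) $G$ has a unique quotient isomorphic to $C_2\times C_2$, i.e. there is exactly one normal subgroup $H$ of $G$ with $G/H\cong C_2\times C_2$. (c) $G$ has a quotient isomorphic to $C_2\times C_2$ and no quotient isomorphic to $C_2\times C_2\times C_2$.
   Context: $C_2$ denotes the cyclic group of order $2$. A subgroup $H$ of $G$ is proper if $H\neq G$. Coverings by three proper subgroups are counted as unordered collections of subgroups, and quotients $G/H$ are counted by the normal subgroups $H$. *)

(* Defs.v *)
From mathcomp Require Import all_boot all_fingroup zmodp.

Set Implicit Arguments.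
Unset Strict Implicit.
Unset Printing Implicit Defensive.

Local Open Scope group_scope.

(* 'Z_2 is the integers mod 2 with addition as its group law, i.e., C_2; the
   product types carry the componentwise (external direct product) law. *)
Definition C2xC2 : {group 'Z_2 * 'Z_2} := [set: 'Z_2 * 'Z_2]%G.

Definition C2xC2xC2 : {group 'Z_2 * 'Z_2 * 'Z_2} := [set: 'Z_2 * 'Z_2 * 'Z_2]%G.

Section QuotientsAndCovers.

Variables (gT rT : finGroupType) (G : {group gT}).

(* For arbitrary H, G / H is only the image in 'N(H) / H of the elements of G
   that normalise H, so normality is required explicitly. *)
Definition quotient_isog_to (K : {group rT}) (H : {group gT}) : Prop :=
  H <| G /\ G / H \isog K.

Definition has_quotient (K : {group rT}) : Prop :=
  exists H : {group gT}, quotient_isog_to K H.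

Definition has_unique_quotient (K : {group rT}) : Prop :=
  exists! H : {group gT}, quotient_isog_to K H.

Definition three_proper_cover (S : {set {group gT}}) : Prop :=
  [/\ #|S| = 3,
      forall H : {group gT}, H \in S -> H \proper G
    & \bigcup_(H in S) H = G :> {set gT}].

End QuotientsAndCovers.

(* Main.v *)
(* A subgroup N of G has an elementary abelian 2-group as quotient iff it
   contains all squares of G, so everything happens among the subgroups
   containing the squares. If G = A :|: B :|: C with three distinct proper
   subgroups, then A :&: B = A :&: C = B :&: C =: N (Scorza), this N contains
   the squares and has index 4. Conversely, if N has index 4 and contains the
   squares, the proper subgroups strictly above N are exactly three, they cover
   G, and they meet in N. Hence covers correspond to quotients C_2 x C_2. Two
   distinct such N, N' give a subgroup of N of index 8 containing the squares;
   conversely adjoining different elements to such a subgroup of index 8 yields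
   different subgroups of index 4. *)
Require Import Defs.
From mathcomp Require Import all_boot all_fingroup zmodp.
From mathcomp Require Import cyclic abelian.

Set Implicit Arguments.
Unset Strict Implicit.
Unset Printing Implicit Defensive.

Local Open Scope group_scope.

Section Squares.

Variable gT : finGroupType.
Implicit Types A B C G H N : {group gT}.

(** * Subgroups containing all squares, and elementary abelian quotients *)

Definition square_kernel G n H : Prop :=
  [/\ H \subset G, {in G, forall x, x ^+ 2 \in H} & #|G : H| = n].

(** A conjugate of [h] is a product of two squares and [h^-1]. *)
Lemma square_kernel_normal G n H : square_kernel G n H -> H <| G.
Proof.
case=> sHG sqH _; apply/andP; split=> //; apply/subsetP=> x Gx.
rewrite inE; apply/subsetP=> _ /imsetP[h Hh ->].
have Gh := subsetP sHG h Hh.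
have ->: h ^ x = x^-1 ^+ 2 * (x * h) ^+ 2 * h^-1.
  by rewrite conjgE !expgS !expg0 !mulg1 -!mulgA mulgV mulg1 mulKg.
by rewrite groupMr ?groupV // groupMl sqH ?groupV ?groupM.
Qed.

(** Elementary abelian 2-groups of equal order are isomorphic, so only exponent and index matter. *)
Lemma quotient_isog_toP (rT : finGroupType) (K : {group rT}) G H :
  2.-abelem K -> quotient_isog_to G K H <-> square_kernel G #|K| H.
Proof.
move=> abK; split=> [[nHG isoHK] | kerH].
  have [sHG nH] := andP nHG.
  have abGH : 2.-abelem (G / H) by rewrite (isog_abelem isoHK).
  split=> // [x Gx|]; last by rewrite -card_quotient // (card_isog isoHK).
  have nHx := subsetP nH x Gx.
  apply: coset_idr; first exact: groupX.
  have [_ sq1] := abelemP (isT : prime 2) abGH.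
  by rewrite morphX //; apply/sq1/mem_quotient.
have nHG := square_kernel_normal kerH.
have [sHG sqH idxH] := kerH; have nH := normal_norm nHG.
have sq1 : {in G / H, forall u, u ^+ 2 = 1}.
  move=> _ /morphimP[x nHx Gx ->] /=.
  by rewrite -morphX //= coset_id ?sqH.
have abGH : 2.-abelem (G / H).
  apply/(abelemP (isT : prime 2)); split=> //.
  apply/centsP=> u Gu v Gv.
  (* Exponent 2 forces commutativity: u v = (u v)^-1 = v^-1 u^-1 = v u. *)
  have sqV w : w \in G / H -> w^-1 = w.
    by move=> Gw; apply/eqP; rewrite eq_invg_mul -(sq1 w Gw).
  by rewrite /commute -[LHS]sqV ?groupM // invMg !sqV.
split=> //; rewrite (isog_abelem_card _ abGH) abK /=.
by rewrite card_quotient // idxH.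
Qed.

(** * Subgroups of index 2 *)

(** The complement of [H] is a single left coset. This pointwise form restricts to subgroups and can
    be checked inside a cover. *)
Lemma index2P G H : H \subset G ->
  #|G : H| = 2 <->
  H \proper G /\ {in G :\: H &, forall y z, y^-1 * z \in H}.
Proof.
move=> sHG; split=> [idx2 | [prHG HVM]].
  split=> [|y z].
    by rewrite properE sHG -indexg_eq1 idx2.
  move=> /setDP[Gy nHy] Gz; rewrite -mem_lcoset.
  suff -> : y *: H = G :\: H by [].
  apply/eqP; rewrite eqEcard card_lcoset cardsD (setIidPr sHG).
  rewrite -(Lagrange sHG) idx2 muln2 -addnn addnK leqnn andbT.
  apply/subsetP=> _ /lcosetP[h Hh ->].
  by rewrite inE groupMr // nHy groupM // (subsetP sHG).
have [_ [y Gy nHy]] := properP prHG.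
have DyH : G :\: H = y *: H.
  apply/setP=> z; rewrite mem_lcoset; apply/idP/idP=> [Gz | Hyz].
    by apply: HVM => //; rewrite inE nHy.
  rewrite -(mulKVg y z) inE groupMr // nHy groupM //.
  exact: subsetP Hyz.
have := cardsID H G; rewrite DyH card_lcoset (setIidPr sHG) addnn -mul2n.
by rewrite -divgS // => <-; rewrite mulnK.
Qed.

Lemma index2_setI G H N : H \subset G -> #|G : H| = 2 ->
  N \subset G -> ~~ (N \subset H) -> #|N : N :&: H| = 2.
Proof.
move=> sHG /(index2P sHG)[_ HVM] sNG nsNH.
apply/(index2P (subsetIl N H : (N :&: H)%G \subset N)); split.
  by rewrite properE subsetIl subsetI subxx.
move=> y z /setDP[Ny nHy] /setDP[Nz nHz].
rewrite !inE Ny Nz /= in nHy nHz.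
rewrite inE groupM ?groupV //=; apply: HVM.
  by rewrite inE nHy (subsetP sNG).
by rewrite inE nHz (subsetP sNG).
Qed.

(** * Subgroups above a kernel *)

(** Since [x ^+ 2] lies in [N], the image of [x] in [G / N] has order 2. *)
Lemma square_kernel_join_cycle G n N x :
    square_kernel G n N -> x \in G -> x \notin N ->
  square_kernel G n./2 (N <*> <[x]>)%G /\
  #|(N <*> <[x]>)%G : N| = 2.
Proof.
move=> kerN Gx nNx; have nNG := square_kernel_normal kerN.
have [sNG sqN idxN] := kerN.
have nNx' := subsetP (normal_norm nNG) x Gx.
have sNxG : N <*> <[x]> \subset G by rewrite join_subG sNG cycle_subG.
have idx2 : #|N <*> <[x]> : N| = 2.
  rewrite -card_quotient; last first.
    by rewrite join_subG normG cycle_subG.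
  rewrite quotientYidl ?cycle_subG // quotient_cycle //.
  apply: nt_prime_order => //; first by rewrite -morphX //= coset_id ?sqN.
  by apply: contra nNx => /eqP/(coset_idr nNx').
split=> //; split=> // [y Gy|].
  by apply: subsetP (sqN y Gy); apply: joing_subl.
have := Lagrange_index sNxG (joing_subl _ _); rewrite /= idx2 idxN => <-.
by rewrite muln2 doubleK.
Qed.

(** For a kernel of index 4, the preimages of the three subgroups of order 2 of the Klein four-group
    [G / N]. *)
Definition between G N : {set {group gT}} :=
  [set H : {group gT} | N \proper H & H \proper G].

(** The join already has index 2 in [G], which leaves no room between it and the proper subgroup
    [H]. *)
Lemma between_eq_join G N H x : square_kernel G 4 N -> H \in between G N ->
  x \in H -> x \notin N -> H = (N <*> <[x]>)%G.
Proof.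
move=> kerN; rewrite inE => /andP[prNH prHG] Hx nNx.
have [sHG nsGH] := andP prHG; have sNH := proper_sub prNH.
have [[sNxG _ idxNx] _] :=
  square_kernel_join_cycle kerN (subsetP sHG x Hx) nNx.
have sNxH : N <*> <[x]> \subset H by rewrite join_subG sNH cycle_subG.
have := Lagrange_index sHG sNxH; rewrite idxNx /= => idx.
apply/val_inj/eqP; rewrite /= eqEsubset sNxH andbT -indexg_eq1.
rewrite eqn_leq indexg_gt0 andbT -(@leq_pmul2l 2) // -[X in _ <= X]idx.
by rewrite leq_mul2r indexg_gt1 nsGH orbT.
Qed.

Lemma join_cycle_between G N x : square_kernel G 4 N ->
  x \in G -> x \notin N -> (N <*> <[x]>)%G \in between G N.
Proof.
move=> kerN Gx nNx.
have [[sNxG _ idxNx] idx2] := square_kernel_join_cycle kerN Gx nNx.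
have [/(_ idx2)[prNx _] _] :=
  index2P (joing_subl N <[x]> : N \subset (N <*> <[x]>)%G).
have [/(_ idxNx)[prG _] _] := index2P (sNxG : (N <*> <[x]>)%G \subset G).
by rewrite inE prNx.
Qed.

(** Double counting of the pairs of [H] and [x] in [H :\: N]: each [H] contributes |N| of them, and
    each of the 3|N| elements of [G :\: N] lies in exactly one [H]. *)
Lemma card_between G N : square_kernel G 4 N -> #|between G N| = 3.
Proof.
move=> kerN; have [sNG _ idxN] := kerN.
apply/eqP; rewrite -(eqn_pmul2r (cardG_gt0 N)) -sum_nat_const; apply/eqP.
transitivity (\sum_(H in between G N) \sum_(x in G :\: N) (x \in H))%N.
  apply: eq_bigr => H bH; move: (bH); rewrite inE => /andP[prNH prHG].
  have [x Hx nNx] := (properP prNH).2.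
  have Gx := subsetP (proper_sub prHG) x Hx.
  have [_ idx2] := square_kernel_join_cycle kerN Gx nNx.
  rewrite -(between_eq_join kerN bH Hx nNx) in idx2.
  rewrite -big_mkcondr sum1_card.
  have -> : #|[pred y | (y \in G :\: N) && (y \in H)]| = #|H :\: N|.
    apply: eq_card => y; rewrite !inE -andbA; congr (_ && _).
    by apply: andb_idl; apply: subsetP (proper_sub prHG) y.
  rewrite cardsD (setIidPr (proper_sub prNH)).
  by rewrite -(Lagrange (proper_sub prNH)) idx2 muln2 -addnn addnK.
rewrite exchange_big /= (eq_bigr (fun=> 1%N)) => [|x].
  rewrite sum1_card cardsD (setIidPr sNG) -(Lagrange sNG) idxN.
  by rewrite -[X in _ - X]muln1 -mulnBr mulnC.
move=> /setDP[Gx nNx]; have bNx := join_cycle_between kerN Gx nNx.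
rewrite (bigD1 (N <*> <[x]>)%G) //= big1 => [|H /andP[bH neqH]].
  by rewrite mem_gen // inE cycle_id orbT.
apply/eqP; rewrite eqb0; apply: contra neqH => Hx.
by rewrite (between_eq_join kerN bH Hx nNx).
Qed.

Lemma between_cover G N :
  square_kernel G 4 N -> three_proper_cover G (between G N).
Proof.
move=> kerN; split=> [|H|]; first exact: card_between.
  by rewrite inE => /andP[].
apply/eqP; rewrite eqEsubset; apply/andP; split.
  by apply/bigcupsP=> H; rewrite inE => /andP[_ /proper_sub].
apply/subsetP=> x Gx; have [Nx | nNx] := boolP (x \in N).
  have /card_gt0P[H bH] : 0 < #|between G N| by rewrite card_between.
  apply/bigcupP; exists H => //; move: bH; rewrite inE => /andP[prNH _].
  exact: subsetP (proper_sub prNH) x Nx.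
apply/bigcupP; exists (N <*> <[x]>)%G; first exact: join_cycle_between.
by rewrite mem_gen // inE cycle_id orbT.
Qed.

(** An [x] outside [N] determines the intermediate subgroup that contains it, but there are
    several. *)
Lemma between_inter_sub G N x : square_kernel G 4 N ->
  (forall H, H \in between G N -> x \in H) -> x \in N.
Proof.
move=> kerN allx; apply: contraT => nNx.
have /card_gt1P[A [B [bA bB /eqP[]]]] : 1 < #|between G N|.
  by rewrite card_between.
by rewrite (between_eq_join kerN bA (allx A bA)) //
           -(between_eq_join kerN bB (allx B bB)).
Qed.

(** [N] is recovered as the intersection of the members of [between G N]. *)
Lemma between_inj G N N' : square_kernel G 4 N -> square_kernel G 4 N' ->
  between G N = between G N' -> N = N'.
Proof.
have sub A B : square_kernel G 4 B -> between G A = between G B -> A \subset B.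
  move=> kerB eqAB; apply/subsetP=> x Ax.
  apply: (between_inter_sub kerB) => H; rewrite -eqAB inE => /andP[prAH _].
  exact: subsetP (proper_sub prAH) x Ax.
move=> kerN kerN' eqNN'; apply/val_inj/eqP.
by rewrite /= eqEsubset !sub.
Qed.

(** * Kernels of index 4 and of index 8 *)

(** Some [H] above [N'] fails to contain [N]: otherwise [N] lies in [N'], and equal indices make
    them equal. As [H] has index 2, it cuts [N] in half. *)
Lemma square_kernel_index8 G N N' :
    square_kernel G 4 N -> square_kernel G 4 N' -> N != N' ->
  exists M, square_kernel G 8 M.
Proof.
move=> kerN kerN' neqNN'; have [sNG sqN idxN] := kerN.
have [sNG' sqN' idxN'] := kerN'.
have [H bH nsNH] : exists2 H, H \in between G N' & ~~ (N \subset H).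
  apply/exists_inP; apply: contraNT neqNN'.
  rewrite negb_exists_in => /forall_inP sN.
  have sNN' : N \subset N'.
    apply/subsetP=> x Nx; apply: (between_inter_sub kerN') => H bH.
    by have /negPn/subsetP -> := sN H bH.
  have := Lagrange_index sNG' sNN'; rewrite idxN idxN' => idx.
  apply/eqP/val_inj/eqP; rewrite /= eqEsubset sNN' -indexg_eq1.
  by rewrite -(@eqn_pmul2l 4) // idx.
move: (bH); rewrite inE => /andP[prNH' prHG].
have [sHG _] := andP prHG.
have [x Hx nNx] := (properP prNH').2.
have [[_ _ idxH] _] :=
  square_kernel_join_cycle kerN' (subsetP sHG x Hx) nNx.
rewrite -(between_eq_join kerN' bH Hx nNx) in idxH.
exists (N :&: H)%G; split=> [|y Gy|].
- by rewrite subIset ?sNG.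
- by rewrite inE sqN //= (subsetP (proper_sub prNH')) ?sqN'.
by rewrite -(Lagrange_index sNG (subsetIl N H)) idxN (index2_setI sHG).
Qed.

Lemma square_kernel_index4_ne G M :
    square_kernel G 8 M ->
  exists N N', [/\ square_kernel G 4 N, square_kernel G 4 N' & N != N'].
Proof.
move=> kerM; have [sMG _ idxM] := kerM.
have [x Gx nMx] : exists2 x, x \in G & x \notin M.
  by apply/subsetPn; rewrite -indexg_gt1 idxM.
have [kerN _] := square_kernel_join_cycle kerM Gx nMx.
have [sNG _ idxN] := kerN.
(* Choosing [y] outside the first join, not merely outside [M], separates the two joins. *)
have [y Gy nNy] : exists2 y, y \in G & y \notin (M <*> <[x]>)%G.
  by apply/subsetPn; rewrite -indexg_gt1 idxN.
have nMy : y \notin M by apply: contra nNy; apply/subsetP/joing_subl.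
have [kerN' _] := square_kernel_join_cycle kerM Gy nMy.
exists (M <*> <[x]>)%G, (M <*> <[y]>)%G; split=> //.
by apply: contra nNy => /eqP->; rewrite mem_gen // inE cycle_id orbT.
Qed.

(** * Covers by three proper subgroups *)

Lemma not_union2 G A B :
  A \proper G -> B \proper G -> A :|: B != G :> {set gT}.
Proof.
move=> prA prB; apply/eqP=> defG.
have [_ [a Ga nAa]] := properP prA; have [_ [b Gb nBb]] := properP prB.
have Ba : a \in B by move: Ga; rewrite -defG inE (negPf nAa).
have Ab : b \in A by move: Gb; rewrite -defG inE (negPf nBb) orbF.
have : a * b \in A :|: B by rewrite defG groupM.
by rewrite inE groupMr // groupMl // (negPf nAa) (negPf nBb).
Qed.

(** Ordered form of a cover, so that one argument serves all three subgroups by permutation. *)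
Definition union3 G A B C : Prop :=
  [/\ A \proper G, B \proper G, C \proper G & A :|: B :|: C = G].

Lemma union3_rot G A B C : union3 G A B C -> union3 G B C A.
Proof. by case=> prA prB prC defG; split; rewrite // setUC setUA. Qed.

Lemma union3_swap G A B C : union3 G A B C -> union3 G B A C.
Proof. by case=> prA prB prC defG; split; rewrite // (setUC B). Qed.

Lemma union3_not_sub G A B C : union3 G A B C -> ~~ (A \subset B).
Proof.
case=> prA prB prC defG; apply: contraL isT => sAB.
by case/eqP: (not_union2 prB prC); rewrite -defG (setUidPr sAB).
Qed.

Lemma union3_exists G A B C :
  union3 G A B C -> exists2 y, y \in C & y \notin A :|: B.
Proof.
case=> prA prB prC defG; apply/subsetPn.
by apply: contra (not_union2 prA prB) => /setUidPl <-; apply/eqP.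
Qed.

(** Translating a [y] that lies only in [C] by an [x] in [A :&: B] stays outside [A] and [B], hence
    in [C]. *)
Lemma union3_setI_sub G A B C : union3 G A B C -> A :&: B \subset C.
Proof.
move=> un; have [y Cy] := union3_exists un; rewrite inE negb_or => /andP[nAy nBy].
have [prA prB prC defG] := un.
apply/subsetP=> x /setIP[Ax Bx].
have : x * y \in G.
  by rewrite groupM ?(subsetP (proper_sub prA) x) ?(subsetP (proper_sub prC) y).
by rewrite -defG !inE (groupMl _ Ax) (groupMl _ Bx) (negPf nAy) (negPf nBy)
           groupMr.
Qed.

Lemma union3_index2 G A B C : union3 G A B C -> #|G : A| = 2.
Proof.
(* If y and z lie in different ones of B and C, then y^-1 * z can only lie in
   A; if both lie in B, go through an element w of C. *)
move=> un; have [prA prB prC defG] := un; have sAG := proper_sub prA.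
have diff B' C' y z : union3 G A B' C' ->
    y \in B' -> z \in C' -> y \notin A -> z \notin A -> y^-1 * z \in A.
  move=> un' By Cz nAy nAz; have [_ /proper_sub sBG /proper_sub sCG defG'] := un'.
  have sBCA := union3_setI_sub (union3_rot un').
  have nCy : y \notin C'.
    by apply: contra nAy => Cy; apply: (subsetP sBCA); rewrite inE By.
  have nBz : z \notin B'.
    by apply: contra nAz => Bz; apply: (subsetP sBCA); rewrite inE Bz.
  have : y^-1 * z \in G.
    by rewrite groupM ?groupV ?(subsetP sBG y) ?(subsetP sCG z).
  rewrite -defG' !inE (@groupMl _ B') ?groupV // (negPf nBz).
  by rewrite (@groupMr _ C') // groupV (negPf nCy) !orbF.
have same B' C' y z : union3 G A B' C' ->
    y \in B' -> z \in B' -> y \notin A -> z \notin A -> y^-1 * z \in A.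
  move=> un' By Bz nAy nAz; have [w Cw] := union3_exists un'.
  rewrite inE negb_or => /andP[nAw _].
  rewrite -(mulgK w y^-1) -mulgA groupM //; first exact: diff By Cw nAy nAw.
  by rewrite -groupV invMg invgK; apply: diff Bz Cw nAz nAw.
have un2 := union3_rot (union3_swap un).
apply/index2P => //; split=> // y z /setDP[Gy nAy] /setDP[Gz nAz].
move: Gy Gz; rewrite -defG !inE (negPf nAy) (negPf nAz) /=.
case/orP=> [By | Cy] /orP[Bz | Cz].
- exact: same un By Bz nAy nAz.
- exact: diff un By Cz nAy nAz.
- exact: diff un2 Cy Bz nAy nAz.
exact: same un2 Cy Cz nAy nAz.
Qed.

Lemma union3_square_kernel G A B C :
  union3 G A B C -> square_kernel G 4 (A :&: B)%G.
Proof.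
move=> un; have [/proper_sub sAG /proper_sub sBG _ _] := un.
have idxA := union3_index2 un; have idxB := union3_index2 (union3_rot un).
have sq H y : H \subset G -> #|G : H| = 2 -> y \in G -> y ^+ 2 \in H.
  move=> sHG /(index2P sHG)[_ HVM] Gy; have [Hy | nHy] := boolP (y \in H).
    exact: groupX.
  (* The index 2 criterion is applied to [y^-1] and [y]. *)
  by rewrite expgS expg1 -{1}[y]invgK HVM // inE ?groupV nHy.
split=> [|y Gy|]; first by rewrite subIset ?sAG.
  by rewrite inE !sq.
rewrite -(Lagrange_index sAG (subsetIl A B)) idxA (index2_setI sBG) //.
exact: union3_not_sub un.
Qed.

Lemma three_proper_cover_between G (S : {set {group gT}}) :
  three_proper_cover G S -> exists2 N, square_kernel G 4 N & S = between G N.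
Proof.
case=> cardS prS defG.
have /card_gt2P[A [B [C [[SA SB SC] [neAB neBC neCA]]]]] : 2 < #|S|.
  by rewrite cardS.
have defS : S = [set A; B; C].
  apply/esym/eqP; rewrite eqEcard cardS; apply/andP; split.
    by apply/subsetP=> H; rewrite !inE => /orP[/orP[]|] /eqP->.
  by rewrite -setUA cardsU1 cards2 !inE negb_or neAB neBC eq_sym neCA.
have un : union3 G A B C.
  split; try exact: prS.
  by rewrite -defG defS !bigcup_setU !big_set1.
have kerN := union3_square_kernel un.
(* Both sets have three members, so one inclusion suffices. *)
exists (A :&: B)%G => //; apply/eqP; rewrite eqEcard card_between // cardS andbT.
apply/subsetP=> H SH; rewrite inE prS // andbT properE.
move: SH; rewrite defS !inE => /orP[/orP[]|] /eqP-> /=.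
- by rewrite subsetIl subsetI subxx (union3_not_sub un).
- by rewrite subsetIr subsetI subxx andbT (union3_not_sub (union3_swap un)).
rewrite (union3_setI_sub un) subsetI negb_and.
by rewrite (union3_not_sub (union3_rot (union3_rot un))).
Qed.

End Squares.

(** * The model groups and the equivalence *)

Lemma abelem_prod (rT1 rT2 : finGroupType) p : prime p ->
  p.-abelem [set: rT1] -> p.-abelem [set: rT2] -> p.-abelem [set: rT1 * rT2].
Proof.
move=> pr_p /(abelemP pr_p)[/centsP c1 e1] /(abelemP pr_p)[/centsP c2 e2].
apply/(abelemP pr_p); split=> [|[x y] _].
  apply/centsP=> -[x y] _ [x' y'] _.
  by congr pair; [exact: c1 (in_setT x) _ (in_setT x')
                 | exact: c2 (in_setT y) _ (in_setT y')].
have -> : (x, y) ^+ p = (x ^+ p, y ^+ p).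
  by elim: p {pr_p e1 e2} => // n IHn; rewrite !expgS IHn.
by rewrite (e1 x (in_setT x)) (e2 y (in_setT y)).
Qed.

Lemma abelem_Z2 : 2.-abelem [set: 'Z_2].
Proof.
apply/abelemP => //; split=> [|x _]; first by apply/centsP=> x _ y _; exact: Zp_mulgC.
by apply/val_inj; case: x => [[|[|]]].
Qed.

Theorem theoremD (gT : finGroupType) (G : {group gT}) :
  [<-> exists! S : {set {group gT}}, three_proper_cover G S;
       has_unique_quotient G C2xC2;
       has_quotient G C2xC2 /\ ~ has_quotient G C2xC2xC2].
Proof.
have ab2 : 2.-abelem C2xC2 by apply: abelem_prod abelem_Z2 abelem_Z2.
have ab3 : 2.-abelem C2xC2xC2 by apply: abelem_prod abelem_Z2.
have card2 : #|C2xC2| = 4 by rewrite cardsT card_prod !card_ord.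
have card3 : #|C2xC2xC2| = 8 by rewrite cardsT !card_prod !card_ord.
have quo2 N := quotient_isog_toP G N ab2.
have quo3 N := quotient_isog_toP G N ab3.
rewrite card2 in quo2; rewrite card3 in quo3.
tfae.
(* A second kernel of index 4 would give a second cover. *)
- case=> S [/three_proper_cover_between[N kerN ->] uniqS].
  exists N; split=> [|N' /quo2 kerN']; first exact/quo2.
  by apply: (between_inj kerN kerN'); apply/uniqS/between_cover.
(* A kernel of index 8 would lie below two kernels of index 4. *)
- case=> N [quoN uniqN]; split; first by exists N.
  case=> M /quo3/square_kernel_index4_ne[A [B [kerA kerB /eqP[]]]].
  have /uniqN <- : quotient_isog_to G C2xC2 A by apply/quo2.
  by apply/uniqN/quo2.
(* Another cover would come from another kernel, and the two would yield one of index 8. *)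
case=> -[N /quo2 kerN] no_quo3; exists (between G N).
split=> [|_ /three_proper_cover_between[N' kerN' ->]]; first exact: between_cover.
congr between; apply/eqP/contraT => neqNN'; case: no_quo3.
by have [M kerM] := square_kernel_index8 kerN kerN' neqNN'; exists M; apply/quo3.
Qed.
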